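(* Let $\mathcal{N}=\mathcal{R}\cup\mathcal{B}$ be a finite set of players partitioned into retailers $\mathcal{R}$ and consumers $\mathcal{B}$, and let $\{S_r\}_{r\in\mathcal{R}}$ be retailer coalitions, $S_r=\{r\}\cup\mathcal{B}_r$ with $\mathcal{B}_r\subset\mathcal{B}$, such that $\bigcup_{r\in\mathcal{R}}S_r=\mathcal{N}$, no $S_r$ contains a retailer other than $r$, and $S_r\cap S_s=\emptyset$ for distinct $r,s\in\mathcal{R}$. Then the retailer coalitions $S_r$, $r\in\mathcal{R}$, are $\mathbb{D}_{hp}$-stable for the game with multiple retailers $(\mathcal{N},\nu)$.
   Context: Viable coalition: a subset of $\mathcal{N}$ containing exactly one retailer, i.e. of the form $\{r\}\cup B$ with $r\in\mathcal{R}$, $B\subset\mathcal{B}$. All other subsets are nonviable. Cost network: each retailer $r$ has an undirected graph with symmetric real edge weights $\omega(\cdot,\cdot)$ (which may depend on $r$) whose edges contain all links $(r,b)$ between $r$ and consumers $b$, and may contain links $(b,d)$ between consumers. For a viable coalition $S\ni r$, $c(S)$ is the total weight of a minimum spanning tree of the subgraph of $r$'s cost network induced on $S$ (with $c(\{r\})=0$). Value function: for a viable coalition $S$ with retailer $r$, $$\nu(S)=\sum_{b\in S\cap\mathcal{B}}\omega(r,b)-c(S),$$ and $\nu(X)=0$ for every nonviable $X\subset\mathcal{N}$ (in particular $\nu(\emptyset)=0$). $\mathbb{D}_{hp}$-stability: the coalition $S_r$ (within the family $\{S_r\}_{r\in\mathcal{R}}$) is $\mathbb{D}_{hp}$-stable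 if 1. for every partition $\{P_{r_1},\dots,P_{r_L}\}$ of $S_r$ (so $\bigcup_{j=1}^L P_{r_j}=S_r$), $\nu(S_r)\ge\sum_{j=1}^L\nu(P_{r_j})$; and 2. for every set $\mathcal{T}\subset\mathcal{R}$ with $|\mathcal{T}|\le|\mathcal{R}|$, $\sum_{r\in\mathcal{T}}\nu(S_r)\ge\nu\bigl(\bigcup_{r\in\mathcal{T}}S_r\bigr)$. *)

(* Defs.v *)
From HB Require Import structures.
From mathcomp Require Import all_boot all_order all_algebra reals.
Set Implicit Arguments.
Unset Strict Implicit.
Unset Printing Implicit Defensive.
Import Order.TTheory GRing.Theory Num.Theory.
Local Open Scope ring_scope.

(** An undirected edge between x and y is the set [[set x; y]]; weights are
    attached to such sets, so that omega(x, y) = omega(y, x) by construction.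
    Only the weights of actual edges are ever used. *)
Record network (R : realType) (N : finType) := Network {
  edges : {set {set N}};
  weight : {set N} -> R
}.

Definition omega (R : realType) (N : finType) (G : network R N) (x y : N) : R :=
  weight G [set x; y].

Definition cost_network (R : realType) (N : finType) (Bs : {set N}) (r : N)
    (G : network R N) : Prop :=
  (forall b, b \in Bs -> [set r; b] \in edges G) /\
  (forall e, e \in edges G ->
     (exists2 b, b \in Bs & e = [set r; b]) \/
     (exists b d, [/\ b \in Bs, d \in Bs, b != d & e = [set b; d]])).

Definition induced_edges (R : realType) (N : finType) (G : network R N)
    (X : {set N}) : {set {set N}} :=
  [set e in edges G | e \subset X].

Definition adj (N : finType) (F : {set {set N}}) : rel N :=
  [rel x y | (x != y) && ([set x; y] \in F)].

(** A cycle has at least 3 vertices, and at most #|N| as they are distinct. *)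
Definition acyclic (N : finType) (F : {set {set N}}) : bool :=
  [forall n : 'I_#|N|.+1, forall p : n.-tuple N,
     (2 < n)%N ==> ~~ ucycleb (adj F) p].

Definition spanning_tree (R : realType) (N : finType) (G : network R N)
    (X : {set N}) (F : {set {set N}}) : bool :=
  [&& F \subset induced_edges G X,
      [forall x in X, forall y in X, connect (adj F) x y]
    & acyclic F].

Definition total_weight (R : realType) (N : finType) (G : network R N)
    (F : {set {set N}}) : R :=
  \sum_(e in F) weight G e.

(** The default [set0] is returned only if X has no spanning tree at all, in
    particular never when X consists of a retailer and some consumers. *)
Definition mst_cost (R : realType) (N : finType) (G : network R N)
    (X : {set N}) : R :=
  total_weight G
    [arg min_(F < set0 | spanning_tree G X F) total_weight G F]%O.

(** X is viable, with retailer r, iff [X :&: Rs = [set r]]. *)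
Definition value (R : realType) (N : finType) (Rs Bs : {set N})
    (G : N -> network R N) (X : {set N}) : R :=
  if [pick r | X :&: Rs == [set r]] is Some r
  then \sum_(b in X :&: Bs) omega (G r) r b - mst_cost (G r) X
  else 0.

Definition Dhp_stable (R : realType) (N : finType) (Rs : {set N})
    (nu : {set N} -> R) (S : N -> {set N}) (r : N) : Prop :=
  (forall P : {set {set N}}, partition P (S r) ->
     \sum_(A in P) nu A <= nu (S r)) /\
  (forall T : {set N}, T \subset Rs -> (#|T| <= #|Rs|)%N ->
     nu (\bigcup_(s in T) S s) <= \sum_(s in T) nu (S s)).

(* Main.v *)
(** A spanning tree of a coalition becomes a spanning tree of the coalition
    enlarged by a consumer b once the link (r, b) is added to it as a leaf.
    Hence an additional consumer b raises the cost by at most omega(r, b), and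
    the value of coalitions with retailer r is monotone; in particular it is
    nonnegative, as {r} has value 0.  In a partition of a retailer coalition
    only the part containing the retailer is viable, and a union of two or more
    retailer coalitions is nonviable, so both stability conditions follow. *)
Require Import Defs.
From HB Require Import structures.
From mathcomp Require Import all_boot all_order all_algebra lra reals.
Set Implicit Arguments.
Unset Strict Implicit.
Unset Printing Implicit Defensive.
Import Order.TTheory GRing.Theory Num.Theory.
Local Open Scope ring_scope.

(** A cycle avoiding [x] uses only edges of [F]. A cycle through [x] would need two distinct
    neighbours of [x], but [r] is the only possible one. *)
Lemma acyclic_leaf (N : finType) (F : {set {set N}}) (r x : N) :
  (forall e, e \in F -> x \notin e) ->
  acyclic F -> acyclic ([set r; x] |: F).
Proof.
move=> xF /forallP aF; apply/forallP => n; apply/forallP => p.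
apply/implyP => n2; apply/negP => cp.
have [xp | xp] := boolP (x \in (p : seq N)); last first.
  have /forallP /(_ p) /implyP /(_ n2) /negP := aF n; apply.
  case/andP: cp => cp up; apply/andP; split=> //.
  apply: (@sub_in_cycle _ (fun y => y \in (p : seq N)) _ _ _ _ _ cp).
    move=> y z yp zp /andP[yz]; rewrite in_setU1 => /orP[/eqP E|yzF].
      have: x \in [set y; z] by rewrite E set22.
      by case/set2P=> E1; [move: yp | move: zp]; rewrite unfold_in -E1 => /(negP xp).
    by apply/andP.
  by apply/allP.
have neighbour y : [set x; y] \in [set r; x] |: F -> x != y -> y = r.
  rewrite in_setU1 => /orP[/eqP E xy | /xF]; last by rewrite set21.
  have: y \in [set r; x] by rewrite -E set22.
  by case/set2P => // E1; rewrite E1 eqxx in xy.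
(* Rotate the cycle to start at [x]: its second and last vertices are both adjacent to [x], so both
   equal [r]. As the length exceeds 2 they are different entries, which contradicts uniqueness. *)
have [i q Eq] := rot_to xp.
have: ucycle (adj ([set r; x] |: F)) (rot i p) by rewrite rot_ucycle.
have: size (rot i p) = n by rewrite size_rot size_tuple.
rewrite Eq; case: q {Eq} => [|y q] /= sq; first by rewrite -sq in n2.
case/lastP: q sq => [|q z] sq; first by rewrite -sq in n2.
case/andP => /= /andP[/andP[xy Exy]].
rewrite rcons_path last_rcons => /andP[_ /andP[zx Ezx]].
case/and3P => _ yq _; move: yq.
have -> : y = r by apply: neighbour.
have -> : z = r by apply: neighbour; rewrite 1?setUC 1?eq_sym.
by rewrite mem_rcons mem_head.
Qed.

Section Trees.
Variables (R : realType) (N : finType) (G : network R N).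
Implicit Types (X : {set N}) (F : {set {set N}}).

Lemma edge_of_tree (X e : {set N}) (F : {set {set N}}) :
  spanning_tree G X F -> e \in F -> e \subset X.
Proof. by case/and3P=> /subsetP sF _ _ /sF; rewrite inE => /andP[]. Qed.

Lemma adj_subset (E F : {set {set N}}) : E \subset F -> subrel (adj E) (adj F).
Proof. by move/subsetP=> EF y z /andP[yz /EF yzF]; apply/andP. Qed.

Lemma adj_sym (F : {set {set N}}) : symmetric (adj F).
Proof. by move=> y z; rewrite /adj /= eq_sym setUC. Qed.

Lemma spanning_tree_leaf (X : {set N}) (F : {set {set N}}) (r x : N) :
  r \in X -> x \notin X -> [set r; x] \in edges G ->
  spanning_tree G X F -> spanning_tree G (x |: X) ([set r; x] |: F).
Proof.
move=> rX xX rxG tF; have /and3P[/subsetP sF /forall_inP cF aF] := tF.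
apply/and3P; split.
- apply/subsetP=> e; rewrite in_setU1 inE => /orP[/eqP->|eF].
    by rewrite rxG subUset !sub1set setU11 in_setU1 rX orbT.
  have:= sF _ eF; rewrite inE => /andP[-> eX] /=.
  exact: subset_trans eX (subsetUr _ _).
(* Connectivity goes through [r]: each vertex reaches [r], and reachability is symmetric. *)
- have to_r y : y \in x |: X -> connect (adj ([set r; x] |: F)) y r.
    rewrite in_setU1 => /orP[/eqP->|yX].
      apply/connect1/andP; split; last by rewrite setUC setU11.
      by apply: contraNneq xX => ->.
    have /forall_inP/(_ r rX) := cF y yX; apply: connect_sub => u v uv.
    exact: connect1 (adj_subset (subsetUr _ _) uv).
  apply/forall_inP=> y yX; apply/forall_inP=> z zX.
  apply: connect_trans (to_r y yX) _.
  by rewrite (sym_connect_sym (@adj_sym _)) to_r.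
- apply: acyclic_leaf aF => e /(edge_of_tree tF) /subsetP eX.
  by apply: contra xX => /eX.
Qed.

Lemma spanning_tree1 (r : N) :
  induced_edges G [set r] = set0 -> spanning_tree G [set r] set0.
Proof.
move=> E0; apply/and3P; split; first exact: sub0set.
  by apply/forall_inP=> y /set1P->; apply/forall_inP=> z /set1P->.
apply/forallP=> n; apply/forallP=> p; apply/implyP=> n2.
have: (2 < size p)%N by rewrite size_tuple.
case: (tval p) => [|y [|z q]] //= _.
by apply/negP=> /andP[/andP[/andP[_]]]; rewrite in_set0.
Qed.

Lemma mst_costP (X : {set N}) (F0 : {set {set N}}) : spanning_tree G X F0 ->
  exists F, [/\ spanning_tree G X F, mst_cost G X = total_weight G F &
    forall F', spanning_tree G X F' -> mst_cost G X <= total_weight G F'].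
Proof.
move=> tF0.
(* The specification of the arg min asks for a default that satisfies the predicate, and [set0] may
   fail to. Since [F0] is a spanning tree, a minimizer is found and the default can be exchanged for
   [F0]. *)
have E : [arg min_(F < set0 | spanning_tree G X F) total_weight G F]%O =
         [arg min_(F < F0 | spanning_tree G X F) total_weight G F]%O.
  rewrite /Order.arg_min /extremum; case: pickP => //= none.
  have [F tF minF] := Order.TotalTheory.arg_minP (total_weight G) tF0.
  have /andP[] := negbT (none F); split=> //.
  by apply/forall_inP=> F' /minF.
rewrite /mst_cost E.
by case: Order.TotalTheory.arg_minP => // F tF minF; exists F.
Qed.

(** A minimum tree of [X] together with the leaf edge competes in the minimum for the larger set. *)
Lemma mst_cost_leaf (X : {set N}) (F0 : {set {set N}}) (r x : N) :
  r \in X -> x \notin X -> [set r; x] \in edges G -> spanning_tree G X F0 ->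
  mst_cost G (x |: X) <= omega G r x + mst_cost G X.
Proof.
move=> rX xX rxG /mst_costP[F [tF -> _]].
have tF' := spanning_tree_leaf rX xX rxG tF.
have [_ [_ _ /(_ _ tF')]] := mst_costP tF'.
rewrite {1}/total_weight big_setU1 //=.
(* The new edge contains [x], so it is not already in [F] and its weight is added exactly once. *)
apply: contra xX => /(edge_of_tree tF) /subsetP; apply.
exact: set22.
Qed.

End Trees.

Section Value.
Variables (R : realType) (N : finType) (Rs Bs : {set N}) (G : N -> network R N).
Hypothesis disjoint_players : [disjoint Rs & Bs].
Hypothesis networks : forall r, r \in Rs -> cost_network Bs r (G r).

Lemma retailerNconsumer (r : N) : r \in Rs -> r \notin Bs.
Proof. by move=> rR; rewrite (disjointFr disjoint_players). Qed.

Lemma consumerNretailer (b : N) : b \in Bs -> b \notin Rs.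
Proof. by move=> bB; rewrite (disjointFl disjoint_players). Qed.

Lemma value_viable (X : {set N}) (r : N) : X :&: Rs = [set r] ->
  value Rs Bs G X = \sum_(b in X :&: Bs) omega (G r) r b - mst_cost (G r) X.
Proof.
rewrite /value => ->; case: pickP => [s /eqP/set1_inj <- //|/(_ r)].
by rewrite eqxx.
Qed.

Lemma value_nonviable (X : {set N}) :
  (forall r, X :&: Rs != [set r]) -> value Rs Bs G X = 0.
Proof. by rewrite /value => nX; case: pickP => // r; rewrite (negbTE (nX r)). Qed.

Lemma viable_coalition (r : N) (B : {set N}) :
  r \in Rs -> B \subset Bs -> (r |: B) :&: Rs = [set r].
Proof.
move=> rR /subsetP sB; apply/setP=> y; rewrite !inE.
case: eqP => [->|_] //=; apply/negP=> /andP[/sB /consumerNretailer].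
by move/negP.
Qed.

(** Every edge of a cost network has a consumer among its endpoints. *)
Lemma induced_edges_retailer (r : N) :
  r \in Rs -> induced_edges (G r) [set r] = set0.
Proof.
move=> rR; apply/setP=> e; rewrite !inE; apply/negP=> /andP[eG /subsetP er].
have [_ /(_ e eG) H] := networks rR.
have [b bB be] : exists2 b, b \in Bs & b \in e.
  case: H => [[b bB ->]|[b [d [bB _ _ ->]]]]; exists b => //; first exact: set22.
  exact: set21.
by move: bB; rewrite (set1P (er b be)); apply/negP/retailerNconsumer.
Qed.

Lemma value_singleton (r : N) : r \in Rs -> value Rs Bs G [set r] = 0.
Proof.
move=> rR; rewrite (@value_viable _ r); last first.
  by have:= viable_coalition rR (sub0set Bs); rewrite setU0.
have E0 := induced_edges_retailer rR.
have [F [/and3P[sF _ _] -> _]] := mst_costP (spanning_tree1 E0).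
move: sF; rewrite E0 subset0 => /eqP->.
rewrite /total_weight !big1 ?subr0 // => b; rewrite inE // in_set1.
by case/andP=> /eqP-> /(negP (retailerNconsumer rR)).
Qed.

(** Attaching the consumers one by one to [r] builds a star. Its existence makes [mst_cost] a
    genuine minimum on viable coalitions. *)
Lemma exists_spanning_tree (r : N) (B : {set N}) : r \in Rs -> B \subset Bs ->
  exists F, spanning_tree (G r) (r |: B) F.
Proof.
move=> rR; have [m] := ubnP #|B|; elim: m B => // m IH B.
have [->|[b bB]] := set_0Vmem B => Bm sB.
  by exists set0; rewrite setU0; apply/spanning_tree1/induced_edges_retailer.
have [|F tF] := IH (B :\ b) _ (subset_trans (subD1set _ _) sB).
  by rewrite (cardsD1 b) bB in Bm.
have bBs := subsetP sB _ bB.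
exists ([set r; b] |: F); rewrite -(setD1K bB) setUCA.
apply: spanning_tree_leaf tF; rewrite ?setU11 //; last by case: (networks rR); auto.
by rewrite !inE eqxx orbF; apply: contraTneq bBs => ->; apply: retailerNconsumer.
Qed.

(** The term [omega (G r) r b] gained in the sum also bounds the rise in cost, whatever its sign. *)
Lemma value_consumer (r b : N) (B : {set N}) :
  r \in Rs -> b \in Bs -> B \subset Bs -> b \notin B ->
  value Rs Bs G (r |: B) <= value Rs Bs G (r |: (b |: B)).
Proof.
move=> rR bBs sB bB; rewrite (value_viable (viable_coalition rR sB)).
rewrite (@value_viable _ r); last by rewrite viable_coalition // subUset sub1set bBs.
have bX : b \notin r |: B.
  rewrite in_setU1 (negbTE bB) orbF.
  by apply: contraTneq bBs => ->; apply: retailerNconsumer.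
have [F tF] := exists_spanning_tree rR sB.
have rbG : [set r; b] \in edges (G r) by case: (networks rR); auto.
have le_cost := mst_cost_leaf (setU11 _ _) bX rbG tF.
have bI : [set b] :&: Bs = [set b] by apply/setIidPl; rewrite sub1set.
rewrite setUCA [(b |: _) :&: _]setIUl bI big_setU1 /=; last first.
  by rewrite in_setI (negbTE bX).
move: le_cost; lra.
Qed.

Lemma value_mono (r : N) (A B : {set N}) : r \in Rs -> A \subset B ->
  B \subset Bs -> value Rs Bs G (r |: A) <= value Rs Bs G (r |: B).
Proof.
move=> rR; have [m] := ubnP #|B|; elim: m B => // m IH B Bm sAB sB.
have [->//|neAB] := eqVneq A B.
(* Remove from [B] a consumer outside [A], so that the inclusion of [A] survives for the
   induction. *)
have /properP[_ [b bB bA]] : A \proper B by rewrite properEneq neAB.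
have sB' := subset_trans (subD1set B b) sB.
apply: le_trans (IH (B :\ b) _ _ sB') _.
- by rewrite (cardsD1 b) bB in Bm.
- by rewrite subsetD1 sAB.
rewrite -{2}(setD1K bB); apply: value_consumer => //; last by rewrite setD11.
exact: subsetP sB _ bB.
Qed.

Lemma value_ge0 (r : N) (B : {set N}) : r \in Rs -> B \subset Bs ->
  0 <= value Rs Bs G (r |: B).
Proof.
move=> rR sB; rewrite -(value_singleton rR) -[X in value _ _ _ X]setU0.
by apply: value_mono; rewrite ?sub0set.
Qed.

Lemma value_partition (r : N) (B : {set N}) (P : {set {set N}}) :
  r \in Rs -> B \subset Bs -> partition P (r |: B) ->
  \sum_(A in P) value Rs Bs G A <= value Rs Bs G (r |: B).
Proof.
move=> rR sB parP; have /and3P[/eqP covP tiP _] := parP.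
have rP : r \in cover P by rewrite covP setU11.
have subP A : A \in P -> A \subset r |: B.
  by move=> AP; rewrite -covP; apply: bigcup_sup.
have pbP := pblock_mem rP.
(* Isolate the block of [r]; every other block turns out to have value 0. *)
rewrite (bigD1 (pblock P r)) //= [X in _ + X]big1 ?addr0.
  have rp : r \in pblock P r by rewrite mem_pblock.
  rewrite -(setD1K rp); apply: value_mono => //.
  by rewrite subDset subP.
(* The retailer of a viable block lies in [r |: B], hence is [r], and the block is then
   [pblock P r]. *)
move=> A /andP[AP neA]; apply: value_nonviable => s; apply/eqP=> E.
have /setIP[sA sR] : s \in A :&: Rs by rewrite E set11.
have := subsetP (subP _ AP) _ sA; rewrite in_setU1 => /orP[/eqP Es|].
  by rewrite -Es (def_pblock tiP AP sA) eqxx in neA.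
by move/(subsetP sB)/consumerNretailer; rewrite sR.
Qed.

End Value.

Theorem theorem6 (R : realType) (N : finType) (Rs Bs : {set N})
  (G : N -> network R N) (S : N -> {set N})
  (players : Rs :|: Bs = [set: N])
  (disjoint_players : [disjoint Rs & Bs])
  (networks : forall r, r \in Rs -> cost_network Bs r (G r))
  (coalitions : forall r, r \in Rs ->
     exists2 Br : {set N}, Br \subset Bs & S r = r |: Br)
  (cover : \bigcup_(r in Rs) S r = [set: N])
  (one_retailer : forall r s, r \in Rs -> s \in Rs -> s != r -> s \notin S r)
  (disjoint_coalitions : forall r s, r \in Rs -> s \in Rs -> r != s ->
     S r :&: S s = set0) :
  forall r, r \in Rs -> Dhp_stable Rs (value Rs Bs G) S r.
Proof.
move=> r rR; split=> [P|T /subsetP sT _].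
  by have [B sB ->] := coalitions r rR; apply: value_partition.
(* For a singleton [T] both sides coincide. Otherwise, including for empty [T], the union has value
   0 and the sum is nonnegative. *)
have [[t ET]|nT] := altP (@existsP _ (fun t => T == [set t])).
  by rewrite (eqP ET) !big_set1.
rewrite value_nonviable => [|t].
  apply: sumr_ge0 => s /sT sR; have [B sB ->] := coalitions s sR.
  exact: value_ge0.
(* The retailers in the union are exactly the members of [T], since each [S s] contains [s] and no
   other retailer. A viable union would thus make [T] a singleton. *)
apply: contraNneq nT => E; apply/existsP; exists t; rewrite -E.
apply/eqP/setP=> s; rewrite in_setI; apply/idP/andP => [sT'|[/bigcupP[u uT su] sR]].
  split; last exact: sT.
  apply/bigcupP; exists s => //.
  by have [B _ ->] := coalitions s (sT s sT'); rewrite setU11.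
have [->//|nsu] := eqVneq s u.
by have := one_retailer u s (sT u uT) sR nsu; rewrite su.
Qed.
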